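(* Let $G=(V,E)$ be a finite simple $r$-regular graph that admits a 3-balanced coloring $\ell:V\to\mathbb{Z}_3$. Then $3\mid r$ and, for $i,j\in\mathbb{Z}_3$ with $i\not\equiv j$, \[ |E_{ij}|=\frac{r|V|}{9},\qquad |E_{ii}|=\frac{r|V|}{18}. \] Moreover $|V_i|=\frac{|V|}{3}$ for every $i\in\mathbb{Z}_3$. Therefore $3\mid |V|$ and $2\mid r|V|$. In particular, if $G$ is cubic ($r=3$), then $|E_{ij}|=\frac{|V|}{3}$, $|E_{ii}|=\frac{|V|}{6}$, and $|V_i|=\frac{|V|}{3}$, so that $6\mid |V|$.
   Context: For a vertex coloring $\ell:V\to\mathbb{Z}_3$, write $V_i=\ell^{-1}(i)$ and $E_{ij}=\{vw\in E : \{\ell(v),\ell(w)\}=\{i,j\}\}$ for $i,j\in\mathbb{Z}_3$. A coloring $\ell:V\to\mathbb{Z}_3$ is (neighborhood) 3-balanced if for every vertex $v$ and all $i,j\in\mathbb{Z}_3$, $|N(v)\cap V_i|=|N(v)\cap V_j|$, where $N(v)$ is the open neighborhood of $v$.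
   Formalization: 3 | r is claimed only when V is nonempty (the empty graph is 1-regular), and |V_i| = |V|/3 and 3 | |V| only when r > 0 (a single isolated vertex with any coloring is a counterexample for r = 0). *)

(* Defs.v *)
From HB Require Import structures.
From mathcomp Require Import all_boot all_order all_algebra.

Set Implicit Arguments.
Unset Strict Implicit.
Unset Printing Implicit Defensive.

Record sgraph := SGraph {
  vertex :> finType;
  adj : rel vertex;
  adj_sym : symmetric adj;
  adj_irrefl : irreflexive adj
}.

Definition nbhd (G : sgraph) (v : G) : {set G} := [set w | adj v w].

Definition edges (G : sgraph) : {set {set G}} :=
  [set [set v; w] | v in [set: G], w in nbhd v].

Definition regular (G : sgraph) (r : nat) : Prop :=
  forall v : G, #|nbhd v| = r.

Definition color_class (G : sgraph) (l : G -> 'Z_3) (i : 'Z_3) : {set G} :=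
  [set v | l v == i].

(* For an edge e = {v, w}, the image l @: e is {l v, l w}. *)
Definition color_edges (G : sgraph) (l : G -> 'Z_3) (i j : 'Z_3) :
    {set {set G}} :=
  [set e in edges G | l @: e == [set i; j]].

Definition balanced3 (G : sgraph) (l : G -> 'Z_3) : Prop :=
  forall (v : G) (i j : 'Z_3),
    #|nbhd v :&: color_class l i| = #|nbhd v :&: color_class l j|.

(* Main.v *)
(* Count darts (ordered pairs of adjacent vertices) instead of edges. Balance
   makes each vertex send exactly r / 3 darts to each class, so there are
   |V_i| * r / 3 darts from V_i to V_j. Reversing darts gives r |V_i| = r |V_j|,
   and summing over i gives r |V| / 9 darts for each pair (i, j). Each edge
   carries two darts, which lie in the same pair of classes when i = j and in
   the two opposite pairs otherwise. *)
Require Import Defs.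
From HB Require Import structures.
From mathcomp Require Import all_boot all_order all_algebra.
From mathcomp Require Import zify.

Set Implicit Arguments.
Unset Strict Implicit.
Unset Printing Implicit Defensive.

Import Order.TTheory GRing.Theory Num.Theory.
Local Open Scope ring_scope.

Definition darts (G : sgraph) (A B : {set G}) : {set G * G} :=
  [set p | [&& adj p.1 p.2, p.1 \in A & p.2 \in B]].

Lemma card_darts (G : sgraph) (A B : {set G}) :
  #|darts A B| = (\sum_(v in A) #|nbhd v :&: B|)%N.
Proof.
rewrite -sum1_card.
under [RHS]eq_bigr do rewrite -sum1_card.
rewrite pair_big_dep /=; apply: eq_bigl => -[v w].
by rewrite !inE /= andbCA.
Qed.

Lemma card_dartsC (G : sgraph) (A B : {set G}) : #|darts A B| = #|darts B A|.
Proof.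
have swapK : involutive (fun p : G * G => (p.2, p.1)) by case.
rewrite -(card_imset _ (inv_inj swapK)); congr #|pred_of_set _|.
apply/setP => -[v w]; apply/imsetP/idP => [[[x y]]|].
  by rewrite !inE /= => /and3P[xy xA yB] [-> ->]; rewrite adj_sym xy xA yB.
rewrite !inE /= => /and3P[vw vB wA]; exists (w, v) => //.
by rewrite !inE /= adj_sym vw vB wA.
Qed.

(** The fibre of [(v, w) |-> {v, w}] over an edge is a pair of opposite darts, distinct by
    irreflexivity. A general [P] serves both colored edges and the handshake count. *)
Lemma card_darts_edges (G : sgraph) (P : pred {set G}) :
  #|[set p : G * G | adj p.1 p.2 && P [set p.1; p.2]]| =
  (2 * #|[set e in edges G | P e]|)%N.
Proof.
rewrite -sum1_card.
rewrite (partition_big (fun p : G * G => [set p.1; p.2])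
          (mem [set e in edges G | P e])) /=; last first.
  move=> [v w]; rewrite !inE /= => /andP[vw ->]; rewrite andbT.
  by apply/imset2P; exists v w; rewrite ?inE.
rewrite mulnC -sum_nat_const; apply: eq_bigr => e.
rewrite inE => /andP[/imset2P[v w _]]; rewrite inE => vw -> Pe.
have vNw : v != w by apply: contraTneq vw => ->; rewrite adj_irrefl.
(* The 2 is recast as [true.+1] to match [cards2], which counts a pair as [(x != y).+1]. *)
rewrite sum1_card -[RHS]/(true.+1).
have <- : ((v, w) != (w, v)) = true by rewrite xpair_eqE negb_and vNw.
rewrite -cards2; apply: eq_card => -[x y]; rewrite !inE unfold_in /= !inE /=.
apply/idP/idP => [/andP[/andP[xy _] /eqP exy]|].
  have xNy : x != y by apply: contraTneq xy => ->; rewrite adj_irrefl.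
  have := set21 x y; have := set22 x y; rewrite exy !inE !xpair_eqE.
  move=> /orP[]/eqP yE /orP[]/eqP xE; move: xNy; rewrite xE yE !eqxx ?orbT //.
by case/orP=> /eqP[-> ->]; rewrite ?[[set w; v]]setUC ?[adj w v]adj_sym vw Pe eqxx.
Qed.

Lemma set2_eqE (T : finType) (a b i j : T) :
  ([set a; b] == [set i; j]) =
  ((a == i) && (b == j)) || ((a == j) && (b == i)).
Proof.
apply/eqP/orP => [E|[]/andP[/eqP-> /eqP->] //]; last by rewrite setUC.
have : a \in [set i; j] by rewrite -E set21.
have : b \in [set i; j] by rewrite -E set22.
have : i \in [set a; b] by rewrite E set21.
have : j \in [set a; b] by rewrite E set22.
rewrite !inE ![i == _]eq_sym ![j == _]eq_sym.
by case: (a == i); case: (a == j); case: (b == i); case: (b == j); auto.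
Qed.

(** The union covers both cases: its two parts coincide when [i = j] and are disjoint otherwise. *)
Lemma card_color_edges (G : sgraph) (l : G -> 'Z_3) (i j : 'Z_3) :
  (2 * #|color_edges l i j|)%N =
  #|darts (color_class l i) (color_class l j)
    :|: darts (color_class l j) (color_class l i)|.
Proof.
rewrite -card_darts_edges; apply: eq_card => -[v w].
by rewrite !inE /= imsetU1 imset_set1 set2_eqE -andb_orr.
Qed.

Lemma handshake (G : sgraph) (r : nat) :
  regular G r -> (2 * #|edges G| = r * #|G|)%N.
Proof.
move=> Greg.
have -> : edges G = [set e in edges G | xpredT e].
  by apply/setP => e; rewrite inE andbT.
rewrite -card_darts_edges -[#|G|]cardsT mulnC -sum_nat_const.
rewrite (eq_bigr (fun v => #|nbhd v :&: setT|)) => [|v _]; last by rewrite setIT.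
by rewrite -card_darts; apply: eq_card => p; rewrite !inE.
Qed.

Lemma sum_card_color_class (G : sgraph) (l : G -> 'Z_3) (A : {set G}) :
  (\sum_i #|A :&: color_class l i| = #|A|)%N.
Proof.
rewrite -[RHS]sum1_card (partition_big l predT) //=.
apply: eq_bigr => i _; rewrite -sum1_card.
by apply: eq_bigl => v; rewrite !inE.
Qed.

Lemma card_balanced (G : sgraph) (r : nat) (l : G -> 'Z_3) (v : G) (i : 'Z_3) :
  regular G r -> balanced3 l -> (3 * #|nbhd v :&: color_class l i| = r)%N.
Proof.
move=> Greg lbal; rewrite -(Greg v) -(sum_card_color_class l (nbhd v)).
by rewrite (eq_bigr _ (fun j _ => lbal v j i)) sum_nat_const card_ord.
Qed.

Section Balanced.
Variables (G : sgraph) (r : nat) (l : G -> 'Z_3).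
Hypotheses (Greg : regular G r) (lbal : balanced3 l).

Lemma card_color_darts (i j : 'Z_3) :
  (3 * #|darts (color_class l i) (color_class l j)| = r * #|color_class l i|)%N.
Proof.
rewrite card_darts big_distrr /=.
under eq_bigr do rewrite (card_balanced _ _ Greg lbal).
by rewrite sum_nat_const mulnC.
Qed.

(** Counting darts between two classes from either end equates [r] times their sizes. The factor [r]
    stays since it may be 0. *)
Lemma card_color_class (i : 'Z_3) : (r * (3 * #|color_class l i|) = r * #|G|)%N.
Proof.
rewrite -[#|G|]cardsT -(sum_card_color_class l [set: G]) big_distrr /=.
rewrite [RHS](eq_bigr (fun=> r * #|color_class l i|)%N) => [|j _].
  by rewrite sum_nat_const card_ord mulnCA.
by rewrite setTI -(card_color_darts j i) card_dartsC card_color_darts.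
Qed.

Lemma card_color_edges_neq (i j : 'Z_3) :
  i != j -> (#|color_edges l i j| * 9 = r * #|G|)%N.
Proof.
move=> iNj; have := card_color_edges l i j.
(* A dart in both sets would have a source colored both [i] and [j]. *)
rewrite cardsU [X in (_ - X)%N]eq_card0 => [|[v w]]; last first.
  by rewrite !inE; apply: contraNF iNj => /= /andP[/and3P[_ /eqP<- _] /and3P[_ ]].
rewrite [#|darts (_ _ j) _|]card_dartsC.
(* With [e] edges and [d] darts from [i] to [j]: [2e = 2d], [3d = r|V_i|] and [3r|V_i| = r|G|]. *)
have := card_color_darts i j; have := card_color_class i; lia.
Qed.

Lemma card_color_edges_eq (i : 'Z_3) :
  (#|color_edges l i i| * 18 = r * #|G|)%N.
Proof.
have := card_color_edges l i i; rewrite setUid.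
have := card_color_darts i i; have := card_color_class i; lia.
Qed.

End Balanced.

Lemma natr_div_eq (F : numFieldType) (m n d : nat) :
  (0 < d)%N -> (m * d = n)%N -> m%:R = n%:R / d%:R :> F.
Proof. by move=> d_gt0 <-; rewrite natrM mulfK // pnatr_eq0 -lt0n. Qed.

(* The fractions are taken in rat, so each equation includes the divisibility
   it implies. The two guards exclude degenerate cases in which the guarded
   claims are false: a graph without vertices is r-regular for every r, and
   every coloring of an edgeless graph (r = 0) is balanced. *)
Theorem theorem3p3 (G : sgraph) (r : nat) (l : G -> 'Z_3)
    (Greg : regular G r) (lbal : balanced3 l) :
  ((0 < #|G|)%N -> (3 %| r)%N) /\
  (forall i j : 'Z_3, i != j ->
     #|color_edges l i j|%:R = (r * #|G|)%N%:R / 9%:R :> rat) /\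
  (forall i : 'Z_3,
     #|color_edges l i i|%:R = (r * #|G|)%N%:R / 18%:R :> rat) /\
  ((0 < r)%N ->
     (forall i : 'Z_3, #|color_class l i|%:R = #|G|%:R / 3%:R :> rat) /\
     (3 %| #|G|)%N) /\
  (2 %| r * #|G|)%N /\
  (r = 3%N ->
     (forall i j : 'Z_3, i != j ->
        #|color_edges l i j|%:R = #|G|%:R / 3%:R :> rat) /\
     (forall i : 'Z_3, #|color_edges l i i|%:R = #|G|%:R / 6%:R :> rat) /\
     (forall i : 'Z_3, #|color_class l i|%:R = #|G|%:R / 3%:R :> rat) /\
     (6 %| #|G|)%N).
Proof.
have class3 : (0 < r)%N -> forall i, (#|color_class l i| * 3 = #|G|)%N.
  move=> r_gt0 i; have /eqP := card_color_class Greg lbal i.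
  by rewrite eqn_pmul2l // mulnC => /eqP.
have dvd3 : (0 < r)%N -> (3 %| #|G|)%N.
  by move=> r_gt0; rewrite -(class3 r_gt0 0) dvdn_mull.
have dvd2 : (2 %| r * #|G|)%N by rewrite -(handshake Greg) dvdn_mulr.
split; first by case/card_gt0P=> v _; rewrite -(card_balanced v 0 Greg lbal) dvdn_mulr.
split=> [i j iNj|]; first exact/natr_div_eq/card_color_edges_neq.
split=> [i|]; first exact/natr_div_eq/card_color_edges_eq.
split=> [r_gt0|]; first by split=> [i|]; [exact/natr_div_eq/class3 | exact: dvd3].
split=> // r3; have r_gt0 : (0 < r)%N by rewrite r3.
split=> [i j iNj|].
  by apply: natr_div_eq => //; have := card_color_edges_neq Greg lbal iNj; lia.
split=> [i|].
  by apply: natr_div_eq => //; have := card_color_edges_eq Greg lbal i; lia.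
split=> [i|]; first exact/natr_div_eq/class3.
(* As 3 is odd, [2 %| 3 * #|G|] makes [#|G|] even. *)
by have := dvd3 r_gt0; move: dvd2; rewrite r3; lia.
Qed.
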